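(* Let $T$ be a centralizable Hopf monad on an autonomous category $\mathcal{C}$, with centralizer $(Z_T,\partial)$. Let $\Omega\colon TZ_T\to Z_TT$ be the canonical distributive law of $T$, let $D_T=Z_T\circ_\Omega T$ (a Hopf monad on $\mathcal{C}$), and let $\eta$ and $u$ be the units of $T$ and $Z_T$ respectively. Then the natural transformation $R=\{R_{X,Y}\}_{X,Y}$ defined by $$R_{X,Y}=\bigl(u_{T(Y)}\otimes Z_T(\eta_X)\bigr)\partial_{X,Y}\colon X\otimes Y\to D_T(Y)\otimes D_T(X)$$ is an R-matrix for the Hopf monad $D_T$.
   Context: Categories are small and monoidal categories are strict, with product $\otimes$ and unit $\mathbf 1$. A monoidal category is autonomous if every object $X$ has a left dual ${}^\vee X$ (with $\mathrm{ev}_X\colon {}^\vee X\otimes X\to\mathbf 1$, $\mathrm{coev}_X\colon \mathbf 1\to X\otimes {}^\vee X$) and a right dual $X^\vee$ (with $\widetilde{\mathrm{ev}}_X\colon X\otimes X^\vee\to \mathbf 1$, $\widetilde{\mathrm{coev}}_X\colon \mathbf 1\to X^\vee\otimes X$). Duals are chosen; ${}^\vee f$, $f^\vee$ are dual morphisms; ${}^\vee T(X)$ means ${}^\vee(T(X))$. A comonoidal functor $F$ is a functor with a coassociative and counital natural transformation $F_2(X,Y)\colon F(X\otimes Y)\to F(X)\otimes F(Y)$, $F_0\colon F(\mathbf 1)\to\mathbf 1$; $F_3(X,Y,Z)=(\mathrm{id}\otimes F_2(Y,Z))F_2(X,Y\otimes Z)$. Comonoidal natural transformations are those compatible with these structures;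 composites are comonoidal by $(GF)_2(X,Y)=G_2(F(X),F(Y))G(F_2(X,Y))$, $(GF)_0=G_0G(F_0)$. A bimonad is a monad $(T,\mu,\eta)$ with a comonoidal structure on $T$ such that $\mu,\eta$ are comonoidal. A left antipode for $T$ is a natural transformation $s^l_X\colon T({}^\vee T(X))\to {}^\vee X$ with $T_0T(\mathrm{ev}_X)T({}^\vee\eta_X\otimes \mathrm{id}_X)=\mathrm{ev}_{T(X)}(s^l_{T(X)}T({}^\vee\mu_X)\otimes \mathrm{id})T_2({}^\vee T(X),X)$ and $(\eta_X\otimes \mathrm{id}_{{}^\vee X})\mathrm{coev}_XT_0=(\mu_X\otimes s^l_X)T_2(T(X),{}^\vee T(X))T(\mathrm{coev}_{T(X)})$. A right antipode is a natural transformation $s^r_X\colon T(T(X)^\vee)\to X^\vee$ with $T_0T(\widetilde{\mathrm{ev}}_X)T(\mathrm{id}_X\otimes\eta_X^\vee)=\widetilde{\mathrm{ev}}_{T(X)}(\mathrm{id}\otimes s^r_{T(X)}T(\mu_X^\vee))T_2(X,T(X)^\vee)$ and $(\mathrm{id}_{X^\vee}\otimes\eta_X)\widetilde{\mathrm{coev}}_XT_0=(s^r_X\otimes\mu_X)T_2(T(X)^\vee,T(X))T(\widetilde{\mathrm{coev}}_{T(X)})$. A Hopf monad is a bimonad on an autonomous category having a left and a right antipode. A centralizer of an endofunctor $T$ is a pair $(Z_T,\partial)$ with $Z_T$ an endofunctor and $\partial_{X,Y}\colon X\otimes Y\to T(Y)\otimes Z_T(X)$ natural in $X,Y$, such that for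 all objects $X,W$ and every natural $\{\xi_Y\colon X\otimes Y\to T(Y)\otimes W\}_Y$ there is a unique $r\colon Z_T(X)\to W$ with $\xi_Y=(\mathrm{id}_{T(Y)}\otimes r)\partial_{X,Y}$ for all $Y$. $T$ is centralizable if it has a centralizer. For $T$ a Hopf monad, $Z_T$ carries the Hopf monad structure with product $m$, unit $u$ and comonoidal structure determined by $(\mathrm{id}\otimes m_X)(\mathrm{id}_{T(Y_1)}\otimes\partial_{Z_T(X),Y_2})(\partial_{X,Y_1}\otimes\mathrm{id}_{Y_2})=(T_2(Y_1,Y_2)\otimes\mathrm{id}_{Z_T(X)})\partial_{X,Y_1\otimes Y_2}$, $u_X=(T_0\otimes\mathrm{id}_{Z_T(X)})\partial_{X,\mathbf 1}$, $(\mathrm{id}_{T(Y)}\otimes(Z_T)_2(X_1,X_2))\partial_{X_1\otimes X_2,Y}=(\mu_Y\otimes\mathrm{id})(\partial_{X_1,T(Y)}\otimes\mathrm{id}_{Z_T(X_2)})(\mathrm{id}_{X_1}\otimes\partial_{X_2,Y})$, $(\mathrm{id}_{T(Y)}\otimes(Z_T)_0)\partial_{\mathbf 1,Y}=\eta_Y$. Set $i_{X,Y}=(\mathrm{ev}_{T(Y)}\otimes\mathrm{id}_{Z_T(X)})(\mathrm{id}_{{}^\vee T(Y)}\otimes\partial_{X,Y})\colon {}^\vee T(Y)\otimes X\otimes Y\to Z_T(X)$. The canonical distributive law of $T$ is the natural transformation $\Omega\colon TZ_T\to Z_TT$ determined by $\Omega_XT(i_{X,Y})=i_{T(X),T(Y)}({}^\vee\mu_Y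 s^l_{T(Y)}T({}^\vee\mu_Y)\otimes\mathrm{id}_{T(X)\otimes T(Y)})T_3({}^\vee T(Y),X,Y)$ for all $X,Y$. It is a comonoidal distributive law of $T$ over $Z_T$. $Z_T\circ_\Omega T$ is the endofunctor $Z_TT$ with product $p_X=m_{T(X)}Z_T^2(\mu_X)Z_T(\Omega_{T(X)})$, unit $e_X=u_{T(X)}\eta_X$, and the composite comonoidal structure; it is a Hopf monad. An R-matrix for a Hopf monad $(D,\mu,\eta)$ on $\mathcal{C}$ is a natural transformation $R_{X,Y}\colon X\otimes Y\to D(Y)\otimes D(X)$ such that for all $X,Y,Z$: $(\mu_Y\otimes\mu_X)R_{D(X),D(Y)}D_2(X,Y)=(\mu_Y\otimes\mu_X)D_2(D(Y),D(X))D(R_{X,Y})$; $(\mathrm{id}_{D(Z)}\otimes D_2(X,Y))R_{X\otimes Y,Z}=(\mu_Z\otimes\mathrm{id}_{D(X)\otimes D(Y)})(R_{X,D(Z)}\otimes\mathrm{id}_{D(Y)})(\mathrm{id}_X\otimes R_{Y,Z})$; $(D_2(Y,Z)\otimes\mathrm{id}_{D(X)})R_{X,Y\otimes Z}=(\mathrm{id}_{D(Y)\otimes D(Z)}\otimes\mu_X)(\mathrm{id}_{D(Y)}\otimes R_{D(X),Z})(R_{X,Y}\otimes\mathrm{id}_Z)$; $(\mathrm{id}_{D(X)}\otimes D_0)R_{\mathbf 1,X}=\eta_X=(D_0\otimes\mathrm{id}_{D(X)})R_{X,\mathbf 1}$. *)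

(* Defs.v *)
Set Implicit Arguments.
Unset Strict Implicit.
Unset Printing Implicit Defensive.

Declare Scope cat_scope.
Delimit Scope cat_scope with cat.
Open Scope cat_scope.

Definition cast (O : Type) (H : O -> O -> Type) (X X' Y Y' : O)
    (eX : X = X') (eY : Y = Y') (f : H X Y) : H X' Y' :=
  match eX in _ = A, eY in _ = B return H A B with
  | eq_refl, eq_refl => f
  end.

Record Category := {
  ob :> Type;
  hom : ob -> ob -> Type;
  idm : forall X, hom X X;
  comp : forall X Y Z, hom Y Z -> hom X Y -> hom X Z;
  comp_id_l : forall X Y (f : hom X Y), comp (idm Y) f = f;
  comp_id_r : forall X Y (f : hom X Y), comp f (idm X) = f;
  comp_assoc : forall W X Y Z (h : hom Y Z) (g : hom X Y) (f : hom W X),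
    comp h (comp g f) = comp (comp h g) f
}.
Arguments hom {c} X Y.
Arguments idm {c} X.
Arguments comp {c X Y Z} g f.

Notation "g ∘ f" := (comp g f) (at level 40, left associativity) : cat_scope.

Record Functor (C : Category) := {
  fobj :> C -> C;
  fmap : forall X Y : C, hom X Y -> hom (fobj X) (fobj Y);
  fmap_id : forall X : C, fmap (idm X) = idm (fobj X);
  fmap_comp : forall (X Y Z : C) (g : hom Y Z) (f : hom X Y),
    fmap (g ∘ f) = fmap g ∘ fmap f
}.
Arguments fmap {C} F {X Y} f : rename.

Definition idF (C : Category) : Functor C.
Proof.
  refine {| fobj := fun X => X; fmap := fun X Y f => f |}; reflexivity.
Defined.

Definition compF (C : Category) (G F : Functor C) : Functor C.
Proof.
  refine {| fobj := fun X => G (F X); fmap := fun X Y f => fmap G (fmap F f) |}.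
  - abstract (intros X; now rewrite !fmap_id).
  - abstract (intros X Y Z g f; now rewrite !fmap_comp).
Defined.
Arguments idF {C}.

Notation "G ⋆ F" := (compF G F) (at level 33, left associativity) : cat_scope.

Record NatTrans (C : Category) (F G : Functor C) := {
  nt :> forall X : C, hom (F X) (G X);
  nt_natural : forall (X Y : C) (f : hom X Y),
    nt Y ∘ fmap F f = fmap G f ∘ nt X
}.

(** Strictness is propositional equality of objects, so the equality of
    morphisms of the last three axioms is taken along these equalities. *)
Record StrictMonoidalCategory := {
  smc_cat :> Category;
  unit : smc_cat;
  tens : smc_cat -> smc_cat -> smc_cat;
  tensm : forall X X' Y Y' : smc_cat,
    hom X X' -> hom Y Y' -> hom (tens X Y) (tens X' Y');
  tensm_id : forall X Y : smc_cat, tensm (idm X) (idm Y) = idm (tens X Y);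
  tensm_comp : forall (X X' X'' Y Y' Y'' : smc_cat)
      (f' : hom X' X'') (f : hom X X') (g' : hom Y' Y'') (g : hom Y Y'),
    tensm (f' ∘ f) (g' ∘ g) = tensm f' g' ∘ tensm f g;
  tens_assoc : forall X Y Z : smc_cat,
    tens (tens X Y) Z = tens X (tens Y Z);
  tens_unit_l : forall X : smc_cat, tens unit X = X;
  tens_unit_r : forall X : smc_cat, tens X unit = X;
  tensm_assoc : forall (X X' Y Y' Z Z' : smc_cat)
      (f : hom X X') (g : hom Y Y') (h : hom Z Z'),
    cast (tens_assoc X Y Z) (tens_assoc X' Y' Z') (tensm (tensm f g) h)
    = tensm f (tensm g h);
  tensm_unit_l : forall (X X' : smc_cat) (f : hom X X'),
    cast (tens_unit_l X) (tens_unit_l X') (tensm (idm unit) f) = f;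
  tensm_unit_r : forall (X X' : smc_cat) (f : hom X X'),
    cast (tens_unit_r X) (tens_unit_r X') (tensm f (idm unit)) = f
}.
Arguments unit {s}.
Arguments tens {s} X Y.
Arguments tensm {s X X' Y Y'} f g.

Notation "X ⊗ Y" := (tens X Y) (at level 34, right associativity) : cat_scope.
Notation "f ⊠ g" := (tensm f g) (at level 34, right associativity) : cat_scope.
Notation "𝟏" := unit : cat_scope.

(** [g ⊚ f], [recast f] and [f ≡ g] are composition, retyping and equality of
    morphisms whose (co)domains agree only up to the object equalities of
    strictness.  Those equalities are found by instance resolution, so an
    ill-typed formula is still rejected. *)
Class ObEq (A : Type) (X Y : A) := ob_eq : X = Y.

Ltac solve_ob_eq :=
  unfold ObEq; cbn;
  repeat first [rewrite tens_assoc | rewrite tens_unit_l | rewrite tens_unit_r];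
  reflexivity.

#[export] Hint Extern 0 (ObEq _ _) => solve_ob_eq : typeclass_instances.

Definition recast (C : StrictMonoidalCategory) (X X' Y Y' : C)
    {eX : ObEq X X'} {eY : ObEq Y Y'} (f : hom X Y) : hom X' Y' :=
  cast (H := @hom C) eX eY f.
Arguments recast {C X X' Y Y' eX eY} f.

Definition comps (C : StrictMonoidalCategory) (X Y Y' Z : C) {e : ObEq Y Y'}
    (g : hom Y' Z) (f : hom X Y) : hom X Z :=
  g ∘ cast (H := @hom C) eq_refl e f.
Arguments comps {C X Y Y' Z e} g f.

Definition eqs (C : StrictMonoidalCategory) (X X' Y Y' : C)
    {eX : ObEq X X'} {eY : ObEq Y Y'} (f : hom X Y) (g : hom X' Y') : Prop :=
  cast (H := @hom C) eX eY f = g.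
Arguments eqs {C X X' Y Y' eX eY} f g.

Notation "g ⊚ f" := (comps g f) (at level 40, left associativity) : cat_scope.
Notation "f ≡ g" := (eqs f g) (at level 70, no associativity) : cat_scope.

Record AutonomousCategory := {
  aut_smc :> StrictMonoidalCategory;
  ldual : aut_smc -> aut_smc;
  ev : forall X : aut_smc, hom (ldual X ⊗ X) 𝟏;
  coev : forall X : aut_smc, hom 𝟏 (X ⊗ ldual X);
  ev_coev : forall X : aut_smc,
    (idm X ⊠ ev X) ⊚ (coev X ⊠ idm X) ≡ idm X;
  coev_ev : forall X : aut_smc,
    (ev X ⊠ idm (ldual X)) ⊚ (idm (ldual X) ⊠ coev X) ≡ idm (ldual X);
  rdual : aut_smc -> aut_smc;
  rev : forall X : aut_smc, hom (X ⊗ rdual X) 𝟏;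
  rcoev : forall X : aut_smc, hom 𝟏 (rdual X ⊗ X);
  rev_rcoev : forall X : aut_smc,
    (rev X ⊠ idm X) ⊚ (idm X ⊠ rcoev X) ≡ idm X;
  rcoev_rev : forall X : aut_smc,
    (idm (rdual X) ⊠ rev X) ⊚ (rcoev X ⊠ idm (rdual X)) ≡ idm (rdual X)
}.
Arguments ldual {a} X.
Arguments ev {a} X.
Arguments coev {a} X.
Arguments rdual {a} X.
Arguments rev {a} X.
Arguments rcoev {a} X.

Definition ldualm (C : AutonomousCategory) (X Y : C) (f : hom X Y) :
    hom (ldual Y) (ldual X) :=
  recast ((ev Y ⊠ idm (ldual X))
          ⊚ (idm (ldual Y) ⊠ f ⊠ idm (ldual X))
          ⊚ (idm (ldual Y) ⊠ coev X)).

Definition rdualm (C : AutonomousCategory) (X Y : C) (f : hom X Y) :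
    hom (rdual Y) (rdual X) :=
  recast ((idm (rdual X) ⊠ rev Y)
          ⊚ (idm (rdual X) ⊠ f ⊠ idm (rdual Y))
          ⊚ (rcoev X ⊠ idm (rdual Y))).

Record ComonoidalData (C : StrictMonoidalCategory) (F : Functor C) := {
  com2 : forall X Y : C, hom (F (X ⊗ Y)) (F X ⊗ F Y);
  com0 : hom (F 𝟏) 𝟏;
  com2_natural : forall (X X' Y Y' : C) (f : hom X X') (g : hom Y Y'),
    com2 X' Y' ∘ fmap F (f ⊠ g) = (fmap F f ⊠ fmap F g) ∘ com2 X Y
}.
Arguments com2 {C F} c X Y.
Arguments com0 {C F} c.

Definition com3 (C : StrictMonoidalCategory) (F : Functor C)
    (c : ComonoidalData F) (X Y Z : C) :
    hom (F (X ⊗ Y ⊗ Z)) (F X ⊗ F Y ⊗ F Z) :=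
  (idm (F X) ⊠ com2 c Y Z) ∘ com2 c X (Y ⊗ Z).

Record IsComonoidal (C : StrictMonoidalCategory) (F : Functor C)
    (c : ComonoidalData F) : Prop := {
  com_coassoc : forall X Y Z : C,
    (idm (F X) ⊠ com2 c Y Z) ∘ com2 c X (Y ⊗ Z)
    ≡ (com2 c X Y ⊠ idm (F Z)) ∘ com2 c (X ⊗ Y) Z;
  com_counit_r : forall X : C,
    (idm (F X) ⊠ com0 c) ∘ com2 c X 𝟏 ≡ idm (F X);
  com_counit_l : forall X : C,
    (com0 c ⊠ idm (F X)) ∘ com2 c 𝟏 X ≡ idm (F X)
}.

Definition idF_com (C : StrictMonoidalCategory) : ComonoidalData (@idF C).
Proof.
  refine {| com2 := fun X Y => idm (X ⊗ Y) : hom (idF (X ⊗ Y)) (idF X ⊗ idF Y);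
            com0 := idm 𝟏 : hom (idF 𝟏) 𝟏 |}.
  abstract (intros; cbn; now rewrite comp_id_l, comp_id_r).
Defined.

Definition compF_com (C : StrictMonoidalCategory) (G F : Functor C)
    (cG : ComonoidalData G) (cF : ComonoidalData F) : ComonoidalData (G ⋆ F).
Proof.
  refine {| com2 := fun X Y =>
              (com2 cG (F X) (F Y) ∘ fmap G (com2 cF X Y)
                : hom ((G ⋆ F) (X ⊗ Y)) ((G ⋆ F) X ⊗ (G ⋆ F) Y));
            com0 := (com0 cG ∘ fmap G (com0 cF) : hom ((G ⋆ F) 𝟏) 𝟏) |}.
  abstract (intros; cbn;
    now rewrite <- comp_assoc, <- fmap_comp, com2_natural, fmap_comp,
                comp_assoc, com2_natural, comp_assoc).
Defined.

Record IsComonoidalNat (C : StrictMonoidalCategory) (F G : Functor C)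
    (cF : ComonoidalData F) (cG : ComonoidalData G) (a : NatTrans F G) : Prop := {
  comnat_2 : forall X Y : C,
    com2 cG X Y ∘ a (X ⊗ Y) = (a X ⊠ a Y) ∘ com2 cF X Y;
  comnat_0 : com0 cG ∘ a 𝟏 = com0 cF
}.

(** The operations of a bimonad on the endofunctor [F], without its axioms. *)
Record BimonadData (C : StrictMonoidalCategory) (F : Functor C) := {
  mult : NatTrans (F ⋆ F) F;
  munit : NatTrans idF F;
  bm_com :> ComonoidalData F
}.
Arguments mult {C F} b.
Arguments munit {C F} b.

Record IsBimonad (C : StrictMonoidalCategory) (F : Functor C)
    (b : BimonadData F) : Prop := {
  mult_assoc : forall X : C,
    mult b X ∘ fmap F (mult b X) = mult b X ∘ mult b (F X);
  mult_unit_l : forall X : C, mult b X ∘ munit b (F X) = idm (F X);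
  mult_unit_r : forall X : C, mult b X ∘ fmap F (munit b X) = idm (F X);
  bm_comonoidal : IsComonoidal b;
  mult_comonoidal : IsComonoidalNat (compF_com b b) b (mult b);
  munit_comonoidal : IsComonoidalNat (idF_com C) b (munit b)
}.

Record LeftAntipode (C : AutonomousCategory) (T : Functor C)
    (b : BimonadData T) := {
  sl :> forall X : C, hom (T (ldual (T X))) (ldual X);
  sl_natural : forall (X Y : C) (f : hom X Y),
    sl X ∘ fmap T (ldualm (fmap T f)) = ldualm f ∘ sl Y;
  sl_ev : forall X : C,
    com0 b ∘ fmap T (ev X) ∘ fmap T (ldualm (munit b X) ⊠ idm X)
    = ev (T X) ∘ ((sl (T X) ∘ fmap T (ldualm (mult b X))) ⊠ idm (T X))
      ∘ com2 b (ldual (T X)) X;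
  sl_coev : forall X : C,
    (munit b X ⊠ idm (ldual X)) ∘ coev X ∘ com0 b
    = (mult b X ⊠ sl X) ∘ com2 b (T X) (ldual (T X)) ∘ fmap T (coev (T X))
}.

Record RightAntipode (C : AutonomousCategory) (T : Functor C)
    (b : BimonadData T) := {
  sr :> forall X : C, hom (T (rdual (T X))) (rdual X);
  sr_natural : forall (X Y : C) (f : hom X Y),
    sr X ∘ fmap T (rdualm (fmap T f)) = rdualm f ∘ sr Y;
  sr_rev : forall X : C,
    com0 b ∘ fmap T (rev X) ∘ fmap T (idm X ⊠ rdualm (munit b X))
    = rev (T X) ∘ (idm (T X) ⊠ (sr (T X) ∘ fmap T (rdualm (mult b X))))
      ∘ com2 b X (rdual (T X));
  sr_rcoev : forall X : C,
    (idm (rdual X) ⊠ munit b X) ∘ rcoev X ∘ com0 b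
    = (sr X ⊠ mult b X) ∘ com2 b (rdual (T X)) (T X) ∘ fmap T (rcoev (T X))
}.

Record HopfMonad (C : AutonomousCategory) := {
  hm_functor :> Functor C;
  hm_data :> BimonadData hm_functor;
  hm_bimonad : IsBimonad hm_data;
  hm_sl : LeftAntipode hm_data;
  hm_sr : RightAntipode hm_data
}.
Arguments hm_sl {C} h.
Arguments hm_sr {C} h.

Record Centralizer (C : StrictMonoidalCategory) (T : Functor C) := {
  cent :> Functor C;
  cent_d : forall X Y : C, hom (X ⊗ Y) (T Y ⊗ cent X);
  cent_d_natural : forall (X X' Y Y' : C) (f : hom X X') (g : hom Y Y'),
    cent_d X' Y' ∘ (f ⊠ g) = (fmap T g ⊠ fmap cent f) ∘ cent_d X Y;
  cent_universal : forall (X W : C) (xi : forall Y : C, hom (X ⊗ Y) (T Y ⊗ W)),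
    (forall (Y Y' : C) (g : hom Y Y'),
       xi Y' ∘ (idm X ⊠ g) = (fmap T g ⊠ idm W) ∘ xi Y) ->
    exists! r : hom (cent X) W,
      forall Y : C, xi Y = (idm (T Y) ⊠ r) ∘ cent_d X Y
}.
Arguments cent_d {C T} c X Y.

Definition cent_i (C : AutonomousCategory) (T : Functor C) (Z : Centralizer T)
    (X Y : C) : hom (ldual (T Y) ⊗ X ⊗ Y) (Z X) :=
  recast ((ev (T Y) ⊠ idm (Z X)) ⊚ (idm (ldual (T Y)) ⊠ cent_d Z X Y)).

(** By the universal property of the centralizer these equations determine
    the product, unit and comonoidal structure [b] of [Z]. *)
Record IsCentralizerStructure (C : AutonomousCategory) (T : HopfMonad C)
    (Z : Centralizer T) (b : BimonadData Z) : Prop := {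
  cs_mult : forall X Y1 Y2 : C,
    (idm (T Y1 ⊗ T Y2) ⊠ mult b X)
      ⊚ (idm (T Y1) ⊠ cent_d Z (Z X) Y2) ⊚ (cent_d Z X Y1 ⊠ idm Y2)
    ≡ (com2 T Y1 Y2 ⊠ idm (Z X)) ∘ cent_d Z X (Y1 ⊗ Y2);
  cs_unit : forall X : C,
    munit b X ≡ (com0 T ⊠ idm (Z X)) ∘ cent_d Z X 𝟏;
  cs_com2 : forall X1 X2 Y : C,
    (idm (T Y) ⊠ com2 b X1 X2) ∘ cent_d Z (X1 ⊗ X2) Y
    ≡ (mult T Y ⊠ idm (Z X1 ⊗ Z X2))
        ⊚ (cent_d Z X1 (T Y) ⊠ idm (Z X2)) ⊚ (idm X1 ⊠ cent_d Z X2 Y);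
  cs_com0 : forall Y : C,
    (idm (T Y) ⊠ com0 b) ∘ cent_d Z 𝟏 Y ≡ munit T Y
}.

Definition IsCanonicalLaw (C : AutonomousCategory) (T : HopfMonad C)
    (Z : Centralizer T) (Omega : NatTrans (T ⋆ Z) (Z ⋆ T)) : Prop :=
  forall X Y : C,
    Omega X ∘ fmap T (cent_i Z X Y)
    = cent_i Z (T X) (T Y)
      ∘ ((ldualm (mult T Y) ∘ hm_sl T (T Y) ∘ fmap T (ldualm (mult T Y)))
         ⊠ idm (T X ⊗ T Y))
      ∘ com3 T (ldual (T Y)) X Y.

Section DistributiveComposite.
Variables (C : StrictMonoidalCategory) (P T : Functor C).
Variables (p : BimonadData P) (t : BimonadData T).
Variable Omega : NatTrans (T ⋆ P) (P ⋆ T).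

Definition dl_mult : NatTrans (P ⋆ T ⋆ (P ⋆ T)) (P ⋆ T).
Proof.
  refine {| nt := fun X =>
    (mult p (T X) ∘ fmap P (fmap P (mult t X)) ∘ fmap P (Omega (T X))
      : hom ((P ⋆ T ⋆ (P ⋆ T)) X) ((P ⋆ T) X)) |}.
  abstract (intros X Y f; cbn;
    pose proof (nt_natural Omega (fmap T f)) as H1;
    pose proof (nt_natural (mult t) f) as H2;
    pose proof (nt_natural (mult p) (fmap T f)) as H3; cbn in H1, H2, H3;
    rewrite <- !comp_assoc, <- fmap_comp, H1, fmap_comp,
      (comp_assoc (fmap P (fmap P _))), <- !fmap_comp, H2, !fmap_comp,
      !comp_assoc, H3; reflexivity).
Defined.

Definition dl_munit : NatTrans idF (P ⋆ T).
Proof.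
  refine {| nt := fun X =>
    (munit p (T X) ∘ munit t X : hom (idF X) ((P ⋆ T) X)) |}.
  abstract (intros X Y f; cbn;
    pose proof (nt_natural (munit t) f) as H1;
    pose proof (nt_natural (munit p) (fmap T f)) as H2; cbn in H1, H2;
    now rewrite <- comp_assoc, H1, comp_assoc, H2, comp_assoc).
Defined.

Definition dl_comp : BimonadData (P ⋆ T) :=
  {| mult := dl_mult; munit := dl_munit; bm_com := compF_com p t |}.
End DistributiveComposite.

Record IsRMatrix (C : StrictMonoidalCategory) (D : Functor C)
    (b : BimonadData D) (R : forall X Y : C, hom (X ⊗ Y) (D Y ⊗ D X)) : Prop := {
  rm_natural : forall (X X' Y Y' : C) (f : hom X X') (g : hom Y Y'),
    R X' Y' ∘ (f ⊠ g) = (fmap D g ⊠ fmap D f) ∘ R X Y;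
  rm_mult : forall X Y : C,
    (mult b Y ⊠ mult b X) ∘ R (D X) (D Y) ∘ com2 b X Y
    = (mult b Y ⊠ mult b X) ∘ com2 b (D Y) (D X) ∘ fmap D (R X Y);
  rm_tens_l : forall X Y Z : C,
    (idm (D Z) ⊠ com2 b X Y) ∘ R (X ⊗ Y) Z
    ≡ (mult b Z ⊠ idm (D X ⊗ D Y))
        ⊚ (R X (D Z) ⊠ idm (D Y)) ⊚ (idm X ⊠ R Y Z);
  rm_tens_r : forall X Y Z : C,
    (com2 b Y Z ⊠ idm (D X)) ∘ R X (Y ⊗ Z)
    ≡ (idm (D Y ⊗ D Z) ⊠ mult b X)
        ⊚ (idm (D Y) ⊠ R (D X) Z) ⊚ (R X Y ⊠ idm Z);
  rm_unit_l : forall X : C,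
    (idm (D X) ⊠ com0 b) ∘ R 𝟏 X ≡ munit b X;
  rm_unit_r : forall X : C,
    (com0 b ⊠ idm (D X)) ∘ R X 𝟏 ≡ munit b X
}.

(* Main.v *)
(** Moving the duals of the defining equation of [Omega] to the other side with
    the left antipode, one finds that [Omega] is characterized by
      (mu_Y ⊗ Omega_X) T_2(TY, ZX) T(d_{X,Y}) = (mu_Y ⊗ id) d_{TX,TY} T_2(X, Y),
    where [d] is the universal transformation of the centralizer.  This gives
    the compatibility of [Omega] with the two units, and the product of [Z T]
    then collapses on all the instances of the units that occur in the axioms
    of an R-matrix.  The only axiom that needs more is the first one; it reduces
    to [cent_d_hexagon], an equality of morphisms with source Z(X ⊗ TY), which
    holds because both sides have the same composite with d_{X ⊗ TY, W}. *)

From Stdlib Require Import ClassicalEpsilon Classical_Prop.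
Require Import Defs.

(** Morphisms bundled with their endpoints.  Composition is total, its value
    being [None] when the endpoints do not match, so that composition and tensor
    product are strictly associative for Leibniz equality, without casts. *)
Record arrow (C : Category) := Arrow {
  src : C;
  tgt : C;
  mor : option (hom src tgt)
}.
Arguments Arrow {C} src tgt mor.
Arguments src {C} a.
Arguments tgt {C} a.
Arguments mor {C} a.

Definition arr {C : Category} {X Y : C} (f : hom X Y) : arrow C :=
  Arrow X Y (Some f).

Definition idA {C : Category} (X : C) : arrow C := arr (idm X).

(** Equality of objects need not be decidable, so matching of endpoints is decided classically; by
    proof irrelevance the chosen equality proof does not affect the value. *)
Definition compA {C : Category} (g f : arrow C) : arrow C :=
  Arrow (src f) (tgt g)
    match excluded_middle_informative (tgt f = src g), mor g, mor f with
    | left e, Some g', Some f' => Some (g' ∘ cast (H := @hom C) eq_refl e f')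
    | _, _, _ => None
    end.

Definition tensA {C : StrictMonoidalCategory} (f g : arrow C) : arrow C :=
  Arrow (src f ⊗ src g) (tgt f ⊗ tgt g)
    match mor f, mor g with
    | Some f', Some g' => Some (f' ⊠ g')
    | _, _ => None
    end.

Definition fmapA {C : Category} (F : Functor C) (f : arrow C) : arrow C :=
  Arrow (F (src f)) (F (tgt f)) (option_map (fmap F) (mor f)).

Declare Scope arrow_scope.
Delimit Scope arrow_scope with arrow.
Bind Scope arrow_scope with arrow.
Infix "·" := compA (at level 40, left associativity) : arrow_scope.
Infix "⊛" := tensA (at level 34, right associativity) : arrow_scope.
Open Scope arrow_scope.

(** * Composition and functors on bundled morphisms *)

Section Arrows.
Context {C : Category}.
Implicit Types (X Y : C) (f g h : arrow C).

(** An equality of arrows gives an equality of morphisms up to casts along proofs of [X = X] and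
    [Y = Y], which are trivial by proof irrelevance. This brings computations with arrows back to
    [hom]. *)
Lemma arr_inj X Y (f g : hom X Y) : arr f = arr g -> f = g.
Proof.
  intros e.
  assert (H : forall a : arrow C, forall (p : arr f = a) (es : src a = X) (et : tgt a = Y),
    option_map (cast (H := @hom C) es et) (mor a) = Some f).
  { intros a [] es et. cbn in *.
    now rewrite (proof_irrelevance _ es eq_refl), (proof_irrelevance _ et eq_refl). }
  specialize (H _ e eq_refl eq_refl). now injection H.
Qed.

Lemma arr_cast X X' Y Y' (eX : X = X') (eY : Y = Y') (f : hom X Y) :
  arr (cast (H := @hom C) eX eY f) = arr f.
Proof. now destruct eX, eY. Qed.

Lemma arr_comp X Y W (g : hom Y W) (f : hom X Y) : arr (g ∘ f) = arr g · arr f.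
Proof.
  unfold compA; cbn. destruct (excluded_middle_informative _) as [e|e]; [|easy].
  now rewrite (proof_irrelevance _ e eq_refl).
Qed.

Lemma compA_assoc h g f : h · (g · f) = h · g · f.
Proof.
  destruct h as [Y Z h], g as [X Y' g], f as [W X' f]; unfold compA; cbn.
  destruct (excluded_middle_informative (Y' = Y)) as [e|e];
  destruct (excluded_middle_informative (X' = X)) as [e'|e'];
  destruct h, g, f; cbn; try reflexivity.
  destruct e, e'; cbn. now rewrite comp_assoc.
Qed.

Lemma compA_id_l X f : tgt f = X -> idA X · f = f.
Proof.
  intros <-; destruct f as [X Y [f|]]; unfold compA; cbn;
  destruct (excluded_middle_informative _) as [e|e]; try easy.
  rewrite (proof_irrelevance _ e eq_refl); cbn. now rewrite comp_id_l.
Qed.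

Lemma compA_id_r X f : src f = X -> f · idA X = f.
Proof.
  intros <-; destruct f as [X Y [f|]]; unfold compA; cbn;
  destruct (excluded_middle_informative _) as [e|e]; try easy.
  rewrite (proof_irrelevance _ e eq_refl); cbn. now rewrite comp_id_r.
Qed.

(** The endpoints have to match: [F] may identify distinct objects, and then the right side alone
    could be defined. *)
Lemma fmapA_comp (F : Functor C) g f :
  src g = tgt f -> fmapA F (g · f) = fmapA F g · fmapA F f.
Proof.
  destruct g as [Y Z g], f as [X Y' f]; cbn; intros ->; unfold compA, fmapA; cbn.
  destruct (excluded_middle_informative _) as [e|e]; [|easy].
  destruct (excluded_middle_informative _) as [e'|e']; [|easy].
  rewrite (proof_irrelevance _ e eq_refl), (proof_irrelevance _ e' eq_refl).
  destruct g, f; cbn; try reflexivity. now rewrite fmap_comp.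
Qed.

Lemma fmapA_id (F : Functor C) X : fmapA F (idA X) = idA (F X).
Proof. unfold fmapA, idA, arr; cbn. now rewrite fmap_id. Qed.

Lemma arr_fmap (F : Functor C) X Y (f : hom X Y) : arr (fmap F f) = fmapA F (arr f).
Proof. reflexivity. Qed.

(** The endpoints of [f] enter through equations, so that they may be matched by strictness when [f]
    is a composite or a tensor product. *)
Lemma nat_arr {F G : Functor C} (a : NatTrans F G) {X Y} f :
  tgt f = Y -> src f = X -> arr (a Y) · fmapA F f = fmapA G f · arr (a X).
Proof.
  intros <- <-. destruct f as [X Y [f|]].
  - change (arr (a Y) · arr (fmap F f) = arr (fmap G f) · arr (a X)).
    now rewrite <- !arr_comp, nt_natural.
  - unfold compA; cbn; now do 2 destruct (excluded_middle_informative _).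
Qed.

Lemma fmapA_compF (F G : Functor C) f : fmapA (G ⋆ F) f = fmapA G (fmapA F f).
Proof. now destruct f as [X Y [f|]]. Qed.

Lemma fmapA_idF f : fmapA idF f = f.
Proof. now destruct f as [X Y [f|]]. Qed.
End Arrows.

(** * Tensor products of bundled morphisms and the universal property *)

Section TensorArrows.
Context {C : StrictMonoidalCategory}.
Implicit Types (X Y : C) (f g h : arrow C).

Lemma arr_tens X X' Y Y' (f : hom X X') (g : hom Y Y') :
  arr (f ⊠ g) = arr f ⊛ arr g.
Proof. reflexivity. Qed.

Lemma arr_comps X Y Y' W {e : ObEq Y Y'} (g : hom Y' W) (f : hom X Y) :
  arr (g ⊚ f) = arr g · arr f.
Proof. unfold comps. now rewrite arr_comp, arr_cast. Qed.

Lemma arr_recast X X' Y Y' {eX : ObEq X X'} {eY : ObEq Y Y'} (f : hom X Y) :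
  arr (recast f : hom X' Y') = arr f.
Proof. apply arr_cast. Qed.

Lemma arr_eqs X X' Y Y' {eX : ObEq X X'} {eY : ObEq Y Y'} (f : hom X Y)
    (g : hom X' Y') : f ≡ g <-> arr f = arr g.
Proof.
  unfold eqs; rewrite <- (arr_cast _ _ _ _ eX eY f). split.
  - now intros ->.
  - apply arr_inj.
Qed.

Lemma tensA_id X Y : idA (X ⊗ Y) = idA X ⊛ idA Y.
Proof. unfold idA; now rewrite <- tensm_id, arr_tens. Qed.

(** Tensor products of objects may agree without their factors agreeing, whence a condition on each
    factor. *)
Lemma tensA_comp g f g' f' : src g = tgt f -> src g' = tgt f' ->
  (g ⊛ g') · (f ⊛ f') = (g · f) ⊛ (g' · f').
Proof.
  destruct g as [Y Z g], f as [X ? f], g' as [Y' Z' g'], f' as [X' ? f'].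
  cbn; intros -> ->; unfold compA, tensA; cbn.
  do 3 (destruct (excluded_middle_informative _) as [?e|?e]; [|easy]).
  rewrite (proof_irrelevance _ e eq_refl), (proof_irrelevance _ e0 eq_refl),
    (proof_irrelevance _ e1 eq_refl).
  destruct g, f, g', f'; cbn; try reflexivity. now rewrite tensm_comp.
Qed.

Lemma Arrow_None X X' Y Y' : X = X' -> Y = Y' ->
  Arrow X Y None = Arrow X' Y' None :> arrow C.
Proof. now intros -> ->. Qed.

Lemma tensA_assoc f g h : (f ⊛ g) ⊛ h = f ⊛ g ⊛ h.
Proof.
  destruct f as [X X' [f|]], g as [Y Y' [g|]], h as [Z Z' [h|]];
  unfold tensA; cbn; try (apply Arrow_None; apply tens_assoc).
  change (arr ((f ⊠ g) ⊠ h) = arr (f ⊠ g ⊠ h)).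
  now rewrite <- tensm_assoc, arr_cast.
Qed.

Lemma tensA_unit_l f : idA 𝟏 ⊛ f = f.
Proof.
  destruct f as [X X' [f|]]; unfold tensA; cbn;
    [|apply Arrow_None; apply tens_unit_l].
  change (arr (idm 𝟏 ⊠ f) = arr f).
  now rewrite <- (tensm_unit_l f) at 2; rewrite arr_cast.
Qed.

Lemma tensA_unit_r f : f ⊛ idA 𝟏 = f.
Proof.
  destruct f as [X X' [f|]]; unfold tensA; cbn;
    [|apply Arrow_None; apply tens_unit_r].
  change (arr (f ⊠ idm 𝟏) = arr f).
  now rewrite <- (tensm_unit_r f) at 2; rewrite arr_cast.
Qed.

Lemma tensA_comp_idl X g f : src g = tgt f ->
  idA X ⊛ (g · f) = (idA X ⊛ g) · (idA X ⊛ f).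
Proof. intros e. now rewrite tensA_comp, compA_id_l. Qed.

Lemma tensA_comp_idr X g f : src g = tgt f ->
  (g · f) ⊛ idA X = (g ⊛ idA X) · (f ⊛ idA X).
Proof. intros e. now rewrite tensA_comp, compA_id_l. Qed.

Lemma com2_arr (F : Functor C) (c : ComonoidalData F) X X' Y Y' f g :
  tgt f = X' -> tgt g = Y' -> src f = X -> src g = Y ->
  arr (com2 c X' Y') · fmapA F (f ⊛ g)
  = (fmapA F f ⊛ fmapA F g) · arr (com2 c X Y).
Proof.
  intros <- <- <- <-. destruct f as [X X' [f|]], g as [Y Y' [g|]].
  1: { change (arr (com2 c X' Y') · arr (fmap F (f ⊠ g))
         = (arr (fmap F f ⊠ fmap F g)) · arr (com2 c X Y)).
       now rewrite <- !arr_comp, com2_natural. }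
  all: unfold compA; cbn; now do 2 destruct (excluded_middle_informative _).
Qed.

Lemma cent_d_arr (T : Functor C) (Z : Centralizer T) X X' Y Y' f g :
  tgt f = X' -> tgt g = Y' -> src f = X -> src g = Y ->
  arr (cent_d Z X' Y') · (f ⊛ g)
  = (fmapA T g ⊛ fmapA Z f) · arr (cent_d Z X Y).
Proof.
  intros <- <- <- <-. destruct f as [X X' [f|]], g as [Y Y' [g|]].
  1: { change (arr (cent_d Z X' Y') · arr (f ⊠ g)
         = (arr (fmap T g ⊠ fmap Z f)) · arr (cent_d Z X Y)).
       now rewrite <- !arr_comp, cent_d_natural. }
  all: unfold compA; cbn; now do 2 destruct (excluded_middle_informative _).
Qed.

(** Both [f] and [g] factor the natural family [(id ⊗ f) d] through [d], so both equal its unique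
    factorization. *)
Lemma cent_arr_unique (T : Functor C) (Z : Centralizer T) X W (f g : hom (Z X) W) :
  (forall Y, (idA (T Y) ⊛ arr f) · arr (cent_d Z X Y)
           = (idA (T Y) ⊛ arr g) · arr (cent_d Z X Y)) ->
  arr f = arr g.
Proof.
  intros H.
  destruct (@cent_universal _ _ Z X W (fun Y => (idm (T Y) ⊠ f) ∘ cent_d Z X Y))
    as [r [_ Hr]].
  - intros Y Y' h. apply arr_inj.
    rewrite <- comp_assoc, cent_d_natural, !comp_assoc, <- !tensm_comp.
    now rewrite fmap_id, !comp_id_l, !comp_id_r.
  - rewrite <- (Hr f), <- (Hr g); trivial.
    intros Y. apply arr_inj. rewrite !arr_comp. apply H.
Qed.
End TensorArrows.

(** * Interchange and rewriting inside composites *)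

Ltac side :=
  cbn; repeat first [rewrite tens_assoc | rewrite tens_unit_l | rewrite tens_unit_r];
  reflexivity.

Lemma tensA_comp_post {C : StrictMonoidalCategory} (x g f g' f' : arrow C) :
  src g = tgt f -> src g' = tgt f' ->
  x · (g ⊛ g') · (f ⊛ f') = x · ((g · f) ⊛ (g' · f')).
Proof. intros e e'. now rewrite <- compA_assoc, tensA_comp. Qed.

(** Proves equalities that follow from functoriality of the tensor product: composites of tensors
    are merged slot by slot and identities removed until both sides agree. *)
Ltac interchange := repeat first
   [ rewrite compA_assoc | rewrite tensA_comp by side | rewrite <- tensA_id
   | rewrite compA_id_l by side | rewrite compA_id_r by side
   | rewrite tensA_comp_post by side];
  rewrite ?tensA_id, ?tensA_assoc, ?compA_assoc; reflexivity.

(** Composites are associated to the left, so an equation about two inner factors applies only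
    together with the prefix [x]. *)
Lemma post2 {C : Category} {a b c : arrow C} (e : a · b = c) x : x · a · b = x · c.
Proof. now rewrite <- e, compA_assoc. Qed.

Lemma post3 {C : Category} {a b c r : arrow C} (e : a · b · c = r) x :
  x · a · b · c = x · r.
Proof. now rewrite <- e, !compA_assoc. Qed.

(** * The axioms of the Hopf monad [T] on arrows *)

Section CanonicalLaw.
Context {C : AutonomousCategory} {T : HopfMonad C} {Z : Centralizer T}.

Definition d (X Y : C) := arr (cent_d Z X Y).
Definition t2 (X Y : C) := arr (com2 T X Y).
Definition t0 := arr (com0 T).
Definition mu (X : C) := arr (mult T X).
Definition eta (X : C) := arr (munit T X).
Notation Tm := (fmapA T).
Notation Zm := (fmapA Z).

Lemma d_nat (X X' Y Y' : C) f g :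
  tgt f = X' -> tgt g = Y' -> src f = X -> src g = Y ->
  d X' Y' · (f ⊛ g) = (Tm g ⊛ Zm f) · d X Y.
Proof. apply cent_d_arr. Qed.

Lemma t2_nat (X X' Y Y' : C) f g :
  tgt f = X' -> tgt g = Y' -> src f = X -> src g = Y ->
  t2 X' Y' · Tm (f ⊛ g) = (Tm f ⊛ Tm g) · t2 X Y.
Proof. apply com2_arr. Qed.

Lemma eta_nat X X' f : tgt f = X' -> src f = X -> eta X' · f = Tm f · eta X.
Proof.
  intros H H'; pose proof (nat_arr (munit T) f H H') as E.
  rewrite fmapA_idF in E; exact E.
Qed.

Lemma mu_assoc X : mu X · Tm (mu X) = mu X · mu (T X).
Proof.
  unfold mu; rewrite <- arr_fmap, <- !arr_comp; apply f_equal.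
  apply (mult_assoc (hm_bimonad T)).
Qed.

Lemma mu_eta_l X : mu X · eta (T X) = idA (T X).
Proof.
  unfold mu, eta, idA; rewrite <- !arr_comp; apply f_equal.
  apply (mult_unit_l (hm_bimonad T)).
Qed.

Lemma mu_eta_r X : mu X · Tm (eta X) = idA (T X).
Proof.
  unfold mu, eta, idA; rewrite <- arr_fmap, <- !arr_comp; apply f_equal.
  apply (mult_unit_r (hm_bimonad T)).
Qed.

Lemma t2_assoc (X Y W : C) :
  (idA (T X) ⊛ t2 Y W) · t2 X (Y ⊗ W) = (t2 X Y ⊛ idA (T W)) · t2 (X ⊗ Y) W.
Proof.
  pose proof (com_coassoc (bm_comonoidal (hm_bimonad T)) X Y W) as H.
  apply arr_eqs in H. rewrite !arr_comp, !arr_tens in H. exact H.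
Qed.

Lemma t2_unit_r (X : C) : (idA (T X) ⊛ t0) · t2 X 𝟏 = idA (T X).
Proof.
  pose proof (com_counit_r (bm_comonoidal (hm_bimonad T)) X) as H.
  apply arr_eqs in H. rewrite !arr_comp, !arr_tens in H. exact H.
Qed.

Lemma t2_unit_l (X : C) : (t0 ⊛ idA (T X)) · t2 𝟏 X = idA (T X).
Proof.
  pose proof (com_counit_l (bm_comonoidal (hm_bimonad T)) X) as H.
  apply arr_eqs in H. rewrite !arr_comp, !arr_tens in H. exact H.
Qed.

Lemma t0_mu : t0 · mu 𝟏 = t0 · Tm t0.
Proof.
  pose proof (comnat_0 (mult_comonoidal (hm_bimonad T))) as H.
  apply (f_equal arr) in H. cbn in H.
  rewrite !arr_comp in H. exact H.
Qed.

Lemma t2_eta (X Y : C) : t2 X Y · eta (X ⊗ Y) = eta X ⊛ eta Y.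
Proof.
  pose proof (comnat_2 (munit_comonoidal (hm_bimonad T)) X Y) as H.
  apply (f_equal arr) in H. cbn in H.
  rewrite comp_id_r, arr_comp in H. exact H.
Qed.

Lemma t0_eta : t0 · eta 𝟏 = idA 𝟏.
Proof.
  pose proof (comnat_0 (munit_comonoidal (hm_bimonad T))) as H.
  apply (f_equal arr) in H. cbn in H. rewrite arr_comp in H. exact H.
Qed.

(** * The structure of the centralizer and the laws of its unit *)

Context {ZT : BimonadData Z} (hZT : IsCentralizerStructure ZT).
Definition m (X : C) := arr (mult ZT X).
Definition u (X : C) := arr (munit ZT X).
Definition z2 (X Y : C) := arr (com2 ZT X Y).
Definition z0 := arr (com0 ZT).

Lemma m_nat X X' f : tgt f = X' -> src f = X -> m X' · Zm (Zm f) = Zm f · m X.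
Proof.
  intros H H'; pose proof (nat_arr (mult ZT) f H H') as E.
  rewrite fmapA_compF in E; exact E.
Qed.

Lemma u_nat X X' f : tgt f = X' -> src f = X -> u X' · f = Zm f · u X.
Proof.
  intros H H'; pose proof (nat_arr (munit ZT) f H H') as E.
  rewrite fmapA_idF in E; exact E.
Qed.

Lemma z2_nat (X X' Y Y' : C) f g :
  tgt f = X' -> tgt g = Y' -> src f = X -> src g = Y ->
  z2 X' Y' · Zm (f ⊛ g) = (Zm f ⊛ Zm g) · z2 X Y.
Proof. apply com2_arr. Qed.

Lemma d_m X Y1 Y2 :
  (idA (T Y1) ⊛ idA (T Y2) ⊛ m X) · (idA (T Y1) ⊛ d (Z X) Y2) · (d X Y1 ⊛ idA Y2)
  = (t2 Y1 Y2 ⊛ idA (Z X)) · d X (Y1 ⊗ Y2).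
Proof.
  pose proof (cs_mult hZT X Y1 Y2) as H. apply arr_eqs in H.
  rewrite !arr_comps, arr_comp, !arr_tens in H.
  rewrite <- tensA_assoc, <- tensA_id. exact H.
Qed.

Lemma d_u X : u X = (t0 ⊛ idA (Z X)) · d X 𝟏.
Proof.
  pose proof (cs_unit hZT X) as H. apply arr_eqs in H.
  rewrite !arr_comp, !arr_tens in H. exact H.
Qed.

Lemma d_z2 X1 X2 Y :
  (idA (T Y) ⊛ z2 X1 X2) · d (X1 ⊗ X2) Y
  = (mu Y ⊛ idA (Z X1) ⊛ idA (Z X2)) · (d X1 (T Y) ⊛ idA (Z X2)) · (idA X1 ⊛ d X2 Y).
Proof.
  pose proof (cs_com2 hZT X1 X2 Y) as H. apply arr_eqs in H.
  rewrite !arr_comps, arr_comp, !arr_tens in H.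
  rewrite <- tensA_id. exact H.
Qed.

Lemma d_z0 Y : (idA (T Y) ⊛ z0) · d 𝟏 Y = eta Y.
Proof.
  pose proof (cs_com0 hZT Y) as H. apply arr_eqs in H.
  rewrite !arr_comp, !arr_tens in H. exact H.
Qed.

(** [cent_arr_unique] compares two morphisms, so each side is first gathered into a single [arr]. *)
Ltac by_cent_unique H :=
  unfold m, u, z2, mu, idA in *;
  do 2 rewrite <- ?arr_fmap, <- ?arr_tens, <- ?arr_comp in *;
  apply cent_arr_unique; intros ?Y;
  rewrite ?arr_comp, ?arr_fmap, ?arr_tens in *; apply H.

(** Composed with [d X Y], this is [d_m] at [Y2 = 𝟏] followed by T_0 on the second factor: the unit
    law of [Z] is the right counit law of T_2. *)
Lemma cent_mult_unit_l X : m X · u (Z X) = idA (Z X).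
Proof.
  enough (H : forall Y, (idA (T Y) ⊛ (m X · u (Z X))) · d X Y
    = (idA (T Y) ⊛ idA (Z X)) · d X Y) by by_cent_unique H.
  intros Y.
  rewrite d_u, !compA_assoc.
  assert (E : m X · (t0 ⊛ idA (Z (Z X))) = (t0 ⊛ idA (Z X)) · (idA (T 𝟏) ⊛ m X)).
  (* Reading [m X] as [idA 𝟏 ⊛ m X] lets T_0 slide past it by interchange. *)
  { rewrite <- (tensA_unit_l (m X)) at 1. interchange. }
  rewrite E. rewrite !tensA_comp_idl by side.
  pose proof (d_m X Y 𝟏) as H. rewrite tensA_unit_r in H. rewrite (post3 H).
  rewrite tens_unit_r, compA_assoc.
  rewrite <- tensA_assoc.
  rewrite tensA_comp by side. rewrite t2_unit_r. rewrite compA_id_l by side. reflexivity.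
Qed.

(** The mirror argument: naturality moves [u X] in front of [d], then [d_m] at [Y1 = 𝟏] reduces the
    claim to the left counit law of T_2. *)
Lemma cent_mult_unit_r X : m X · Zm (u X) = idA (Z X).
Proof.
  enough (H : forall Y, (idA (T Y) ⊛ (m X · Zm (u X))) · d X Y
    = (idA (T Y) ⊛ idA (Z X)) · d X Y) by by_cent_unique H.
  intros Y.
  rewrite tensA_comp_idl by side.
  assert (E : (idA (T Y) ⊛ Zm (u X)) · d X Y = d (Z X) Y · (u X ⊛ idA Y)).
  { rewrite d_nat with (X := X) (Y := Y) by side. now rewrite fmapA_id. }
  rewrite <- compA_assoc, E, d_u.
  rewrite tensA_comp_idr by side. rewrite !compA_assoc.
  assert (E2 : (idA (T Y) ⊛ m X) · d (Z X) Y · ((t0 ⊛ idA (Z X)) ⊛ idA Y)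
    = (t0 ⊛ idA (T Y) ⊛ idA (Z X)) · ((idA (T 𝟏) ⊛ idA (T Y) ⊛ m X) · (idA (T 𝟏) ⊛ d (Z X) Y))).
  { rewrite tensA_assoc, <- (tensA_unit_l (_ · d _ _)). interchange. }
  rewrite E2. rewrite <- !compA_assoc.
  pose proof (d_m X 𝟏 Y) as H. rewrite <- compA_assoc in H. rewrite H.
  rewrite tens_unit_l, compA_assoc, <- tensA_assoc.
  rewrite tensA_comp, t2_unit_l, compA_id_l by side. reflexivity.
Qed.

(** Expanding the units by [d_u], the left side carries T_0 after [mu 𝟏] by [d_z2], the right side
    T_0 after T(T_0) by naturality of [d]; these agree by [t0_mu]. *)
Lemma cent_unit_com2 (X Y : C) : z2 X Y · u (X ⊗ Y) = u X ⊛ u Y.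
Proof.
  rewrite (d_u (X ⊗ Y)), compA_assoc.
  assert (E : z2 X Y · (t0 ⊛ idA (Z (X ⊗ Y))) = (t0 ⊛ idA (Z X) ⊛ idA (Z Y)) · (idA (T 𝟏) ⊛ z2 X Y)).
  { rewrite <- tensA_id. rewrite <- (tensA_unit_l (z2 X Y)) at 1. interchange. }
  rewrite E, (post2 (d_z2 X Y 𝟏)).
  assert (E2 : (d X 𝟏 ⊛ idA (Z Y)) · (idA X ⊛ t0 ⊛ idA (Z Y))
    = (Tm t0 ⊛ idA (Z X) ⊛ idA (Z Y)) · (d X (T 𝟏) ⊛ idA (Z Y))).
  { rewrite <- !tensA_assoc, <- !tensA_comp_idr by side.
    erewrite d_nat by side. now rewrite fmapA_id. }
  rewrite (d_u X), (d_u Y).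
  transitivity ((((t0 ⊛ idA (Z X)) · d X 𝟏) ⊛ idA (Z Y))
    · (idA X ⊛ ((t0 ⊛ idA (Z Y)) · d Y 𝟏))); [|interchange].
  rewrite tensA_comp_idl, tensA_comp_idr, tensA_assoc, !compA_assoc by side.
  rewrite (post2 E2), !compA_assoc.
  assert (E3 : (t0 ⊛ idA (Z X) ⊛ idA (Z Y)) · (mu 𝟏 ⊛ idA (Z X) ⊛ idA (Z Y))
    = (t0 ⊛ idA (Z X) ⊛ idA (Z Y)) · (Tm t0 ⊛ idA (Z X) ⊛ idA (Z Y))).
  { rewrite !(tensA_comp t0), t0_mu by side. reflexivity. }
  now rewrite E3.
Qed.

Lemma cent_unit_com0 : z0 · u 𝟏 = idA 𝟏.
Proof.
  rewrite (d_u 𝟏), compA_assoc.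
  assert (E : z0 · (t0 ⊛ idA (Z 𝟏)) = t0 · (idA (T 𝟏) ⊛ z0)).
  { rewrite <- (tensA_unit_l z0) at 1. rewrite <- (tensA_unit_r t0) at 2. interchange. }
  now rewrite E, (post2 (d_z0 𝟏)), t0_eta.
Qed.

(** * The canonical law freed from duals by the left antipode *)

Context {Omega : NatTrans (T ⋆ Z) (Z ⋆ T)} (hOmega : IsCanonicalLaw Omega).
Definition om (X : C) := arr (Omega X).
Definition evA (X : C) := arr (ev X).
Definition coevA (X : C) := arr (coev X).
Definition s (X : C) := arr (hm_sl T X).
Definition ld {X Y : C} (f : hom X Y) := arr (ldualm f).
Definition ci (X Y : C) := arr (cent_i Z X Y).

Lemma om_nat X X' f : tgt f = X' -> src f = X -> om X' · Tm (Zm f) = Zm (Tm f) · om X.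
Proof.
  intros H H'; pose proof (nat_arr Omega f H H') as E.
  rewrite !fmapA_compF in E; exact E.
Qed.

Lemma ci_d X Y : ci X Y = (evA (T Y) ⊛ idA (Z X)) · (idA (ldual (T Y)) ⊛ d X Y).
Proof. unfold ci, cent_i. rewrite arr_recast, arr_comps. reflexivity. Qed.

Lemma zigzag X : (idA X ⊛ evA X) · (coevA X ⊛ idA X) = idA X.
Proof.
  pose proof (ev_coev X) as H. apply arr_eqs in H. now rewrite arr_comps in H.
Qed.

(** Dinaturality of the coevaluation: the evaluation inside [ldualm f] cancels against the outer
    coevaluation by [zigzag]. *)
Lemma ld_coev X Y (f : hom X Y) :
  (idA Y ⊛ ld f) · coevA Y = (arr f ⊛ idA (ldual X)) · coevA X.
Proof.
  unfold ld, ldualm; rewrite arr_recast, !arr_comps, !arr_tens.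
  fold (evA Y) (coevA X) (idA (ldual X)) (idA (ldual Y)).
  rewrite <- compA_assoc, <- tensA_comp_idl by side.
  set (g := _ · coevA X).
  rewrite tensA_comp_idl by side.
  assert (E : (idA Y ⊛ idA (ldual Y) ⊛ g) · coevA Y
    = (coevA Y ⊛ idA Y ⊛ idA (ldual X)) · g).
  { rewrite <- (tensA_unit_r (coevA Y)) at 1. rewrite <- (tensA_unit_l g) at 2.
    rewrite <- (tensA_assoc (idA Y)). interchange. }
  rewrite (post2 E), !compA_assoc, <- !tensA_assoc.
  rewrite <- tensA_comp_idr by side. rewrite zigzag.
  rewrite <- tensA_id. now rewrite compA_id_l by side.
Qed.

(** Transposing along the dual of [T Y] is invertible, so [d] is recovered from [ci]. *)
Lemma ci_coev X Y :
  (idA (T Y) ⊛ ci X Y) · (coevA (T Y) ⊛ idA X ⊛ idA Y) = d X Y.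
Proof.
  rewrite ci_d, tensA_comp_idl by side.
  assert (E : (idA (T Y) ⊛ idA (ldual (T Y)) ⊛ d X Y) · (coevA (T Y) ⊛ idA X ⊛ idA Y)
    = (coevA (T Y) ⊛ idA (T Y) ⊛ idA (Z X)) · d X Y).
  { rewrite <- (tensA_unit_l (d X Y)) at 2. rewrite <- (tensA_assoc (idA (T Y))). interchange. }
  rewrite (post2 E), !compA_assoc, <- !tensA_assoc.
  rewrite <- tensA_comp_idr, zigzag by side.
  rewrite <- tensA_id. now rewrite compA_id_l by side.
Qed.

Lemma s_coev X : (eta X ⊛ idA (ldual X)) · coevA X · t0
  = (mu X ⊛ s X) · t2 (T X) (ldual (T X)) · Tm (coevA (T X)).
Proof.
  pose proof (f_equal arr (sl_coev (hm_sl T) X)) as H.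
  rewrite !arr_comp in H. exact H.
Qed.

(** The dual of [mu Y] crosses the coevaluation by [ld_coev] and becomes T(mu) on the first factor.
    Associativity of mu then exposes the antipode axiom [s_coev] at [T Y], whose [eta] is absorbed
    by [mu Y]. *)
Lemma antipode_coev Y :
  (mu Y ⊛ (s (T Y) · Tm (ld (mult T Y)))) · t2 (T Y) (ldual (T Y)) · Tm (coevA (T Y))
  = coevA (T Y) · t0.
Proof.
  set (l := ld (mult T Y)).
  assert (E : mu Y ⊛ (s (T Y) · Tm l) = (mu Y ⊛ s (T Y)) · (Tm (idA (T Y)) ⊛ Tm l))
    by (rewrite fmapA_id; interchange).
  rewrite E. clear E.
  assert (E : (Tm (idA (T Y)) ⊛ Tm l) · t2 (T Y) (ldual (T Y))
    = t2 (T Y) (ldual (T (T Y))) · Tm (idA (T Y) ⊛ l)) by (symmetry; apply t2_nat; side).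
  rewrite (post2 E), !compA_assoc. clear E.
  assert (E : Tm (idA (T Y) ⊛ l) · Tm (coevA (T Y))
    = Tm (mu Y ⊛ idA (ldual (T (T Y)))) · Tm (coevA (T (T Y)))).
  { rewrite <- !fmapA_comp by side. unfold l. now rewrite ld_coev. }
  rewrite (post2 E), !compA_assoc. clear E.
  assert (E : t2 (T Y) (ldual (T (T Y))) · Tm (mu Y ⊛ idA (ldual (T (T Y))))
    = (Tm (mu Y) ⊛ idA (T (ldual (T (T Y))))) · t2 (T (T Y)) (ldual (T (T Y)))).
  { rewrite <- (fmapA_id T (ldual (T (T Y)))). apply t2_nat; side. }
  rewrite (post2 E), !compA_assoc. clear E.
  assert (E : (mu Y ⊛ s (T Y)) · (Tm (mu Y) ⊛ idA (T (ldual (T (T Y)))))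
    = (mu Y ⊛ idA (ldual (T Y))) · (mu (T Y) ⊛ s (T Y))).
  { rewrite !tensA_comp, mu_assoc, compA_id_l, compA_id_r by side. reflexivity. }
  rewrite E. clear E.
  pose proof (s_coev (T Y)) as H. symmetry in H. rewrite (post3 H).
  rewrite !compA_assoc, tensA_comp, mu_eta_l, compA_id_l, <- tensA_id by side.
  now rewrite compA_id_l by side.
Qed.

Lemma om_cent_d X Y :
  (mu Y ⊛ om X) · t2 (T Y) (Z X) · Tm (d X Y)
  = (mu Y ⊛ idA (Z (T X))) · d (T X) (T Y) · t2 X Y.
Proof.
  (* [K] is the antipode factor in the defining equation of [Omega]; [HK] says how it vanishes
     against a coevaluation. *)
  set (K := ld (mult T Y) · (s (T Y) · Tm (ld (mult T Y)))).
  assert (HO : om X · Tm (ci X Y) = ci (T X) (T Y) · (K ⊛ t2 X Y) · t2 (ldual (T Y)) (X ⊗ Y)).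
  { pose proof (f_equal arr (hOmega X Y)) as H. unfold com3 in H.
    rewrite !arr_comp, !arr_tens, !arr_comp in H.
    assert (E : K ⊛ t2 X Y = (K ⊛ idA (T X ⊗ T Y)) · (idA (T (ldual (T Y))) ⊛ t2 X Y)) by interchange.
    rewrite E, !compA_assoc. unfold K. rewrite !compA_assoc in *. exact H. }
  assert (HK : (mu Y ⊛ K) · t2 (T Y) (ldual (T Y)) · Tm (coevA (T Y))
    = (mu Y ⊛ idA (ldual (T (T Y)))) · coevA (T (T Y)) · t0).
  { assert (E : mu Y ⊛ K = (idA (T Y) ⊛ ld (mult T Y)) · (mu Y ⊛ (s (T Y) · Tm (ld (mult T Y)))))
      by (unfold K; interchange).
    rewrite E, (post3 (antipode_coev Y)), !compA_assoc, ld_coev. reflexivity. }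
  rewrite <- (ci_coev X Y), fmapA_comp by side.
  rewrite compA_assoc.
  assert (E : t2 (T Y) (Z X) · Tm (idA (T Y) ⊛ ci X Y)
    = (idA (T (T Y)) ⊛ Tm (ci X Y)) · t2 (T Y) (ldual (T Y) ⊗ X ⊗ Y)).
  { rewrite <- (fmapA_id T (T Y)). apply t2_nat; side. }
  rewrite (post2 E). clear E.
  assert (E : (mu Y ⊛ om X) · (idA (T (T Y)) ⊛ Tm (ci X Y))
    = (idA (T Y) ⊛ ci (T X) (T Y)) · (mu Y ⊛ K ⊛ t2 X Y) · (idA (T (T Y)) ⊛ t2 (ldual (T Y)) (X ⊗ Y))).
  { rewrite tensA_comp, HO by side. interchange. }
  rewrite !compA_assoc, E. clear E.
  (* Coassociativity groups [T Y] with its dual, so that the coevaluation can be split off and [HK]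
     applied. *)
  rewrite (post2 (t2_assoc (T Y) (ldual (T Y)) (X ⊗ Y))), !compA_assoc.
  assert (E : t2 (T Y ⊗ ldual (T Y)) (X ⊗ Y) · Tm (coevA (T Y) ⊛ idA X ⊛ idA Y)
    = (Tm (coevA (T Y)) ⊛ idA (T (X ⊗ Y))) · t2 𝟏 (X ⊗ Y)).
  { rewrite <- tensA_id, <- (fmapA_id T (X ⊗ Y)). apply t2_nat; side. }
  rewrite (post2 E), !compA_assoc. clear E.
  assert (E : (mu Y ⊛ K ⊛ t2 X Y) · (t2 (T Y) (ldual (T Y)) ⊛ idA (T (X ⊗ Y)))
     · (Tm (coevA (T Y)) ⊛ idA (T (X ⊗ Y)))
    = (mu Y ⊛ idA (ldual (T (T Y))) ⊛ idA (T X) ⊛ idA (T Y)) · (coevA (T (T Y)) ⊛ idA (T X) ⊛ idA (T Y))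
      · t2 X Y · (t0 ⊛ idA (T (X ⊗ Y)))).
  { transitivity (((mu Y ⊛ K) · t2 (T Y) (ldual (T Y)) · Tm (coevA (T Y))) ⊛ t2 X Y).
    - rewrite <- tensA_assoc. interchange.
    - rewrite HK.
      transitivity (((mu Y ⊛ idA (ldual (T (T Y)))) ⊛ idA (T X) ⊛ idA (T Y))
        · (coevA (T (T Y)) ⊛ idA (T X) ⊛ idA (T Y)) · (t0 ⊛ t2 X Y)); [interchange|].
      assert (E : t0 ⊛ t2 X Y = t2 X Y · (t0 ⊛ idA (T (X ⊗ Y))))
        by (rewrite <- (tensA_unit_l (t2 X Y)) at 2; interchange).
      now rewrite E, tensA_assoc, !compA_assoc. }
  rewrite (post3 E), !compA_assoc. clear E.
  rewrite (post2 (t2_unit_l (X ⊗ Y))), compA_id_r by side.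
  assert (E : (idA (T Y) ⊛ ci (T X) (T Y)) · (mu Y ⊛ idA (ldual (T (T Y))) ⊛ idA (T X) ⊛ idA (T Y))
     = (mu Y ⊛ idA (Z (T X))) · (idA (T (T Y)) ⊛ ci (T X) (T Y))) by interchange.
  rewrite E. rewrite (post2 (ci_coev (T X) (T Y))). reflexivity.
Qed.

(** This is [om_cent_d] at [Y = 𝟏] followed by T_0: [d_u] produces the unit on both sides, and
    [t0_mu] exchanges T_0 mu with T_0 T(T_0). *)
Lemma om_unit X : om X · Tm (u X) = u (T X).
Proof.
  assert (E0 : (t0 ⊛ om X) · (Tm t0 ⊛ idA (T (Z X))) · t2 (T 𝟏) (Z X) · Tm (d X 𝟏)
    = om X · Tm (u X)).
  { assert (E : (Tm t0 ⊛ idA (T (Z X))) · t2 (T 𝟏) (Z X)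
      = t2 𝟏 (Z X) · Tm (t0 ⊛ idA (Z X))).
    { rewrite <- (fmapA_id T (Z X)). symmetry. apply t2_nat; side. }
    rewrite (post2 E), !compA_assoc, <- compA_assoc, <- fmapA_comp, <- d_u by side.
    assert (E1 : t0 ⊛ om X = om X · (t0 ⊛ idA (T (Z X))))
      by (rewrite <- (tensA_unit_l (om X)) at 2; interchange).
    rewrite E1, (post2 (t2_unit_l (Z X))). now rewrite compA_id_r by side. }
  rewrite <- E0, tensA_comp, <- t0_mu by side.
  assert (E1 : (t0 · mu 𝟏) ⊛ (om X · idA (T (Z X))) = (t0 ⊛ idA (Z (T X))) · (mu 𝟏 ⊛ om X))
    by interchange.
  rewrite E1, (post3 (om_cent_d X 𝟏)), !compA_assoc, tensA_comp, t0_mu by side.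
  assert (E2 : (t0 · Tm t0) ⊛ (idA (Z (T X)) · idA (Z (T X)))
    = (t0 ⊛ idA (Z (T X))) · (Tm t0 ⊛ Zm (idA (T X)))) by (rewrite fmapA_id; interchange).
  rewrite E2.
  assert (E3 : (Tm t0 ⊛ Zm (idA (T X))) · d (T X) (T 𝟏) = d (T X) 𝟏 · (idA (T X) ⊛ t0))
    by (symmetry; apply d_nat; side).
  rewrite (post2 E3), !compA_assoc, <- d_u, (post2 (t2_unit_r X)).
  now rewrite compA_id_r by side.
Qed.

(** Precomposing [om_cent_d] with [eta (X ⊗ Y)], which is comonoidal, lets [mu Y] absorb a unit on
    either side; what is left is the claim composed with [d X Y]. *)
Lemma om_eta X : om X · eta (Z X) = Zm (eta X).
Proof.
  enough (H : forall Y, (idA (T Y) ⊛ (om X · eta (Z X))) · d X Y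
    = (idA (T Y) ⊛ Zm (eta X)) · d X Y)
    by (unfold om, eta in *; by_cent_unique H).
  intros Y.
  transitivity ((mu Y ⊛ om X) · t2 (T Y) (Z X) · Tm (d X Y) · eta (X ⊗ Y)).
  - rewrite <- (compA_assoc _ (Tm _)), <- (eta_nat _ (T Y ⊗ Z X)) by side.
    rewrite compA_assoc, (post2 (t2_eta _ _)), tensA_comp, mu_eta_l by side. reflexivity.
  - rewrite om_cent_d, (post2 (t2_eta _ _)).
    assert (E : d (T X) (T Y) · (eta X ⊛ eta Y) = (Tm (eta Y) ⊛ Zm (eta X)) · d X Y)
      by (apply d_nat; side).
    rewrite (post2 E), !compA_assoc, tensA_comp, mu_eta_r, compA_id_l by side.
    reflexivity.
Qed.

Lemma cent_d_hexagon X Y :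
  ((Zm (mu Y) · om (T Y)) ⊛ m X) · d (Z X) (Z (T Y)) · z2 X (T Y)
  = (Zm (mu Y) ⊛ m X) · z2 (T (T Y)) (Z X) · Zm (d X (T Y)).
Proof.
  enough (H : forall W,
    (idA (T W) ⊛ (((Zm (mu Y) · om (T Y)) ⊛ m X) · d (Z X) (Z (T Y)) · z2 X (T Y)))
      · d (X ⊗ T Y) W
    = (idA (T W) ⊛ ((Zm (mu Y) ⊛ m X) · z2 (T (T Y)) (Z X) · Zm (d X (T Y))))
      · d (X ⊗ T Y) W).
  { unfold om, d in *. by_cent_unique H. }
  intros W.
  (* Naturality of [d] in its first variable with respect to [mu Y]; it is used for both sides. *)
  assert (D : (idA (T W) ⊛ Zm (mu Y)) · (mu W ⊛ idA (Z (T (T Y)))) · d (T (T Y)) (T W)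
    = (mu W ⊛ idA (Z (T Y))) · d (T Y) (T W) · (mu Y ⊛ idA (T W))).
  { transitivity ((mu W ⊛ idA (Z (T Y))) · ((Tm (idA (T W)) ⊛ Zm (mu Y)) · d (T (T Y)) (T W))).
    - rewrite fmapA_id. interchange.
    - rewrite <- (compA_assoc (mu W ⊛ _)). apply f_equal. symmetry; apply d_nat; side. }
  (* The common value of the two composites with [d (X ⊗ T Y) W]. *)
  transitivity ((mu W ⊛ idA (Z (T Y)) ⊛ idA (Z X)) · (d (T Y) (T W) ⊛ idA (Z X))
    · (mu Y ⊛ idA (T W) ⊛ idA (Z X)) · (t2 (T Y) W ⊛ idA (Z X)) · d X (T Y ⊗ W)).
  - rewrite !tensA_comp_idl, (post2 (d_z2 X (T Y) W)), !compA_assoc by side.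
    assert (E : (idA (T W) ⊛ (Zm (mu Y) · om (T Y)) ⊛ m X) · (idA (T W) ⊛ d (Z X) (Z (T Y)))
        · (mu W ⊛ idA (Z X) ⊛ idA (Z (T Y)))
      = (mu W ⊛ (Zm (mu Y) · om (T Y)) ⊛ idA (Z X)) · ((idA (T (T W)) ⊛ idA (T (Z (T Y))) ⊛ m X)
        · (idA (T (T W)) ⊛ d (Z X) (Z (T Y))))) by interchange.
    rewrite E, !compA_assoc. clear E.
    rewrite (post3 (d_m X (T W) (Z (T Y)))), !compA_assoc.
    assert (E : d X (T W ⊗ Z (T Y)) · (idA X ⊛ d (T Y) W)
      = (Tm (d (T Y) W) ⊛ Zm (idA X)) · d X (T Y ⊗ W)) by (apply d_nat; side).
    rewrite (post2 E), fmapA_id, !compA_assoc. clear E. apply (f_equal (fun x => x · _)).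
    (* Apart from the factor [Z X], this is the left side of [om_cent_d] at [T Y] and [W], followed
       by Z(mu_Y). *)
    transitivity (((idA (T W) ⊛ Zm (mu Y)) · ((mu W ⊛ om (T Y)) · t2 (T W) (Z (T Y)) · Tm (d (T Y) W)))
      ⊛ idA (Z X)); [rewrite <- tensA_assoc; interchange|].
    rewrite om_cent_d, !compA_assoc, D, !tensA_comp_idr, !tensA_assoc by side. reflexivity.
  - rewrite !tensA_comp_idl by side.
    (* Naturality takes [d X (T Y)] out of Z, after which [d_z2] and [d_m] apply. *)
    assert (E : (idA (T W) ⊛ Zm (d X (T Y))) · d (X ⊗ T Y) W
      = d (T (T Y) ⊗ Z X) W · (d X (T Y) ⊛ idA W)).
    { rewrite <- (fmapA_id T W). symmetry; apply d_nat; side. }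
    rewrite (post2 E), compA_assoc, (post2 (d_z2 (T (T Y)) (Z X) W)), !compA_assoc.
    clear E.
    assert (E : (idA (T W) ⊛ Zm (mu Y) ⊛ m X) · (mu W ⊛ idA (Z (T (T Y))) ⊛ idA (Z (Z X)))
        · (d (T (T Y)) (T W) ⊛ idA (Z (Z X)))
      = (mu W ⊛ idA (Z (T Y)) ⊛ idA (Z X)) · (d (T Y) (T W) ⊛ idA (Z X))
        · (mu Y ⊛ idA (T W) ⊛ idA (Z X)) · (idA (T (T Y)) ⊛ idA (T W) ⊛ m X)).
    { transitivity (((idA (T W) ⊛ Zm (mu Y)) · (mu W ⊛ idA (Z (T (T Y)))) · d (T (T Y)) (T W))
        ⊛ m X); [rewrite <- !tensA_assoc; interchange|].
      rewrite D, <- !tensA_assoc. interchange. }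
    rewrite E. clear E.
    rewrite (post3 (d_m X (T Y) W)), !compA_assoc. reflexivity.
Qed.

(** * The product of [Z ⋆ T] on instances of the units *)

Definition dmult (X : C) := m (T X) · Zm (Zm (mu X)) · Zm (om (T X)).

Lemma dmult_u X : dmult X · u (T (Z (T X))) = Zm (mu X) · om (T X).
Proof.
  unfold dmult.
  rewrite <- (compA_assoc _ (Zm (om _))), <- (u_nat (T (Z (T X))) (Z (T (T X)))) by side.
  rewrite compA_assoc, <- (compA_assoc _ (Zm (Zm _))), <- (u_nat (Z (T (T X))) (Z (T X))) by side.
  now rewrite !compA_assoc, cent_mult_unit_l, compA_id_l by side.
Qed.

(** By [om_eta] the law sends [eta] to Z(eta), which [mu] absorbs. *)
Lemma dmult_eta X : dmult X · Zm (eta (Z (T X))) = m (T X).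
Proof.
  unfold dmult.
  rewrite <- (compA_assoc _ (Zm (om _))), <- fmapA_comp, om_eta, <- (compA_assoc (m _)) by side.
  rewrite <- !fmapA_comp, mu_eta_l, !fmapA_id by side. now rewrite compA_id_r by side.
Qed.

(** By [om_unit] the law sends T(u) to [u], which passes [mu] by naturality and is absorbed by
    [m]. *)
Lemma dmult_Tu X : dmult X · Zm (Tm (u (T X))) = Zm (mu X).
Proof.
  unfold dmult.
  rewrite <- (compA_assoc _ (Zm (om _))), <- fmapA_comp, om_unit, <- (compA_assoc (m _)) by side.
  rewrite <- !fmapA_comp, <- (u_nat (T (T X)) (T X)), fmapA_comp by side.
  now rewrite compA_assoc, cent_mult_unit_r, compA_id_l by side.
Qed.

Lemma dmult_TZeta X : dmult X · Zm (Tm (Zm (eta X))) = m (T X) · Zm (om X).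
Proof.
  unfold dmult.
  rewrite <- (compA_assoc _ (Zm (om _))), <- fmapA_comp, (om_nat X (T X)), <- (compA_assoc (m _)) by side.
  rewrite <- !fmapA_comp, compA_assoc, <- !fmapA_comp, mu_eta_r, !fmapA_id by side.
  now rewrite compA_id_l by side.
Qed.

(** * The axioms of an R-matrix *)

Definition R X Y := (u (T Y) ⊛ Zm (eta X)) · d X Y.

Lemma R_mult X Y :
  (dmult Y ⊛ dmult X) · R (Z (T X)) (Z (T Y)) · (z2 (T X) (T Y) · Zm (t2 X Y))
  = (dmult Y ⊛ dmult X) · (z2 (T (Z (T Y))) (T (Z (T X))) · Zm (t2 (Z (T Y)) (Z (T X))))
    · Zm (Tm (R X Y)).
Proof.
  unfold R. rewrite !fmapA_comp, !compA_assoc by side.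
  rewrite tensA_comp, dmult_u, dmult_eta by side.
  (* With the units collapsed, the left side is that of the hexagon at [T X] and [Y], preceded by
     Z(T_2). *)
  rewrite cent_d_hexagon.
  assert (E : Zm (t2 (Z (T Y)) (Z (T X))) · Zm (Tm (u (T Y) ⊛ Zm (eta X)))
    = Zm (Tm (u (T Y)) ⊛ Tm (Zm (eta X))) · Zm (t2 (T Y) (Z X))).
  { rewrite <- !fmapA_comp by side. apply f_equal, t2_nat; side. }
  rewrite (post2 E), !compA_assoc. clear E.
  assert (E : z2 (T (Z (T Y))) (T (Z (T X))) · Zm (Tm (u (T Y)) ⊛ Tm (Zm (eta X)))
    = (Zm (Tm (u (T Y))) ⊛ Zm (Tm (Zm (eta X)))) · z2 (T (T Y)) (T (Z X)))
    by (apply z2_nat; side).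
  rewrite (post2 E), !compA_assoc, tensA_comp, dmult_Tu, dmult_TZeta by side. clear E.
  assert (E : forall x, x · z2 (T (T Y)) (T (Z X)) · Zm (t2 (T Y) (Z X)) · Zm (Tm (d X Y))
    = x · (z2 (T (T Y)) (T (Z X)) · Zm (t2 (T Y) (Z X) · Tm (d X Y))))
    by (intros; now rewrite fmapA_comp, !compA_assoc by side).
  rewrite E. clear E.
  assert (E : Zm (mu Y) ⊛ (m (T X) · Zm (om X))
    = (idA (Z (T Y)) ⊛ m (T X)) · (Zm (mu Y) ⊛ Zm (om X))) by interchange.
  rewrite E. clear E.
  assert (E : (Zm (mu Y) ⊛ Zm (om X)) · z2 (T (T Y)) (T (Z X))
    = z2 (T Y) (Z (T X)) · Zm (mu Y ⊛ om X)) by (symmetry; apply z2_nat; side).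
  rewrite !compA_assoc, (post2 E), !compA_assoc. clear E.
  (* Under Z, [om_cent_d] trades T_2 after [d] for [d] after T_2, as on the other side of the
     hexagon. *)
  assert (E : Zm (mu Y ⊛ om X) · Zm (t2 (T Y) (Z X) · Tm (d X Y))
    = Zm (mu Y ⊛ idA (Z (T X))) · Zm (d (T X) (T Y)) · Zm (t2 X Y)).
  { rewrite <- !fmapA_comp, compA_assoc, om_cent_d by side. reflexivity. }
  rewrite (post2 E), !compA_assoc. clear E.
  assert (E : z2 (T Y) (Z (T X)) · Zm (mu Y ⊛ idA (Z (T X)))
    = (Zm (mu Y) ⊛ idA (Z (Z (T X)))) · z2 (T (T Y)) (Z (T X))).
  { rewrite <- (fmapA_id Z (Z (T X))). apply z2_nat; side. }
  rewrite (post2 E), !compA_assoc, tensA_comp by side.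
  now rewrite compA_id_l, compA_id_r by side.
Qed.

(** This is [d_z2] with units inserted: [eta] splits because it is comonoidal, and the [mu] of
    [d_z2] matches the product of [Z ⋆ T]. *)
Lemma R_tens_l X Y W :
  (idA (Z (T W)) ⊛ (z2 (T X) (T Y) · Zm (t2 X Y))) · R (X ⊗ Y) W
  = (dmult W ⊛ idA (Z (T X)) ⊛ idA (Z (T Y))) · (R X (Z (T W)) ⊛ idA (Z (T Y)))
    · (idA X ⊛ R Y W).
Proof.
  unfold R.
  transitivity ((u (T W) ⊛ Zm (eta X) ⊛ Zm (eta Y)) · (mu W ⊛ idA (Z X) ⊛ idA (Z Y))
    · (d X (T W) ⊛ idA (Z Y)) · (idA X ⊛ d Y W)).
  - rewrite (post3 (eq_sym (d_z2 X Y W))).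
    assert (E : z2 (T X) (T Y) · Zm (t2 X Y) · Zm (eta (X ⊗ Y))
      = (Zm (eta X) ⊛ Zm (eta Y)) · z2 X Y).
    { rewrite <- compA_assoc, <- fmapA_comp, t2_eta by side. apply z2_nat; side. }
    transitivity ((u (T W) ⊛ (z2 (T X) (T Y) · Zm (t2 X Y) · Zm (eta (X ⊗ Y)))) · d (X ⊗ Y) W).
    + interchange.
    + rewrite E. interchange.
  - assert (E : (d X (Z (T W)) ⊛ idA (Z (T Y))) · (idA X ⊛ u (T W) ⊛ Zm (eta Y))
      = (Tm (u (T W)) ⊛ idA (Z X) ⊛ Zm (eta Y)) · (d X (T W) ⊛ idA (Z Y))).
    { rewrite <- !tensA_assoc, !tensA_comp by side. rewrite <- (fmapA_id Z X).
      erewrite d_nat by side. rewrite compA_id_l, compA_id_r by side. reflexivity. }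
    rewrite tensA_comp_idl, tensA_comp_idr, tensA_assoc, !compA_assoc, (post2 E), !compA_assoc by side.
    do 2 apply (f_equal (fun x => x · _)).
    rewrite !tensA_comp by side.
    (* The two instances of [R] contribute [u] and T(u); the product merges them into one [u] after
       [mu W]. *)
    assert (E2 : dmult W · u (T (Z (T W))) · Tm (u (T W)) = u (T W) · mu W).
    { now rewrite dmult_u, <- compA_assoc, om_unit, <- (u_nat (T (T W)) (T W)) by side. }
    rewrite E2. interchange.
Qed.

(** This is [d_m] with units inserted: [cent_unit_com2] splits [u], and [dmult_eta] reduces the
    product of [Z ⋆ T] to [m]. *)
Lemma R_tens_r X Y W :
  ((z2 (T Y) (T W) · Zm (t2 Y W)) ⊛ idA (Z (T X))) · R X (Y ⊗ W)
  = (idA (Z (T Y)) ⊛ idA (Z (T W)) ⊛ dmult X) · (idA (Z (T Y)) ⊛ R (Z (T X)) W)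
    · (R X Y ⊛ idA W).
Proof.
  unfold R.
  assert (E : z2 (T Y) (T W) · Zm (t2 Y W) · u (T (Y ⊗ W)) = (u (T Y) ⊛ u (T W)) · t2 Y W).
  { now rewrite <- compA_assoc, <- (u_nat (T (Y ⊗ W)) (T Y ⊗ T W)), compA_assoc, cent_unit_com2 by side. }
  transitivity ((u (T Y) ⊛ u (T W) ⊛ Zm (eta X)) · (t2 Y W ⊛ idA (Z X)) · d X (Y ⊗ W)).
  { transitivity (((z2 (T Y) (T W) · Zm (t2 Y W) · u (T (Y ⊗ W))) ⊛ Zm (eta X)) · d X (Y ⊗ W)).
    - interchange.
    - rewrite E, <- tensA_assoc. interchange. }
  clear E. rewrite <- compA_assoc, <- d_m, !compA_assoc.
  assert (E : d (Z (T X)) W · (Zm (eta X) ⊛ idA W) = (idA (T W) ⊛ Zm (Zm (eta X))) · d (Z X) W).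
  { rewrite <- (fmapA_id T W). apply d_nat; side. }
  assert (E2 : (idA (Z (T Y)) ⊛ d (Z (T X)) W) · (u (T Y) ⊛ Zm (eta X) ⊛ idA W)
    = (u (T Y) ⊛ idA (T W) ⊛ Zm (Zm (eta X))) · (idA (T Y) ⊛ d (Z X) W))
    by (rewrite !tensA_comp, E by side; interchange).
  rewrite tensA_comp_idl, tensA_comp_idr, tensA_assoc, !compA_assoc, (post2 E2), !compA_assoc by side.
  do 2 apply (f_equal (fun x => x · _)).
  transitivity (u (T Y) ⊛ u (T W) ⊛ (dmult X · Zm (eta (Z (T X))) · Zm (Zm (eta X)))); [|interchange].
  rewrite dmult_eta, (m_nat X (T X)) by side. interchange.
Qed.

Lemma R_unit_l X : (idA (Z (T X)) ⊛ (z0 · Zm t0)) · R 𝟏 X = u (T X) · eta X.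
Proof.
  unfold R. rewrite <- (d_z0 X).
  transitivity ((u (T X) ⊛ (z0 · Zm (t0 · eta 𝟏))) · d 𝟏 X).
  - rewrite fmapA_comp by side. interchange.
  - rewrite t0_eta, fmapA_id. rewrite <- (tensA_unit_r (u (T X))) at 2. interchange.
Qed.

(** T_0 passes [u] by naturality, [cent_unit_com0] cancels the counit of [Z], and the remaining T_0
    yields [u X] by [d_u]. *)
Lemma R_unit_r X : ((z0 · Zm t0) ⊛ idA (Z (T X))) · R X 𝟏 = u (T X) · eta X.
Proof.
  unfold R.
  rewrite (u_nat X (T X)), (d_u X) by side.
  transitivity (((z0 · (Zm t0 · u (T 𝟏))) ⊛ Zm (eta X)) · d X 𝟏); [interchange|].
  rewrite <- (u_nat (T 𝟏) 𝟏), compA_assoc, cent_unit_com0, compA_id_l by side.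
  rewrite <- (tensA_unit_l (Zm (eta X))) at 2. interchange.
Qed.

Lemma R_nat X X' Y Y' f g :
  tgt f = X' -> tgt g = Y' -> src f = X -> src g = Y ->
  R X' Y' · (f ⊛ g) = (Zm (Tm g) ⊛ Zm (Tm f)) · R X Y.
Proof.
  intros <- <- <- <-. unfold R.
  rewrite <- compA_assoc, (d_nat (src f) _ (src g)), !compA_assoc, !tensA_comp by side.
  rewrite <- (u_nat (T (src g)) (T (tgt g))), <- !fmapA_comp, <- (eta_nat (src f) (tgt f)) by side.
  reflexivity.
Qed.
End CanonicalLaw.

Theorem theorem6p4 (C : AutonomousCategory) (T : HopfMonad C)
    (Z : Centralizer T)
    (ZT : BimonadData Z) (hZT : IsCentralizerStructure ZT)
    (Omega : NatTrans (T ⋆ Z) (Z ⋆ T)) (hOmega : IsCanonicalLaw Omega) :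
  IsRMatrix (dl_comp ZT T Omega)
    (fun X Y : C =>
       (munit ZT (T Y) ⊠ fmap Z (munit T X)) ∘ cent_d Z X Y).
Proof.
  (* Passing to arrows removes the strictness casts from the axioms, leaving exactly the equations
     proved above. *)
  split; intros; match goal with |- eqs _ _ => apply arr_eqs | _ => apply arr_inj end; cbn;
    rewrite ?arr_comps; do 3 rewrite ?arr_comp, ?arr_tens, ?arr_fmap.
  - apply R_nat; reflexivity.
  - apply (R_mult hZT hOmega).
  - rewrite <- tensm_id. apply (R_tens_l hZT hOmega).
  - rewrite <- tensm_id, arr_tens, tensA_assoc. apply (R_tens_r hZT hOmega).
  - apply (R_unit_l hZT).
  - apply (R_unit_r hZT).
Qed.
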